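(* Consider the Diophantine equation $$F_{n_1}F_{n_2}F_{n_3}\cdots F_{n_k}+1 = L_m^2$$ in integers $m\geq 0$, $k\geq 1$, and $0\leq n_1\leq n_2\leq \cdots \leq n_k$. For a given $m\ge 0$, it has a solution if and only if $m\in\{0,2,4\}$ or $m$ is odd. Moreover, the nontrivial solutions are exactly those given by \begin{align*} &F_4+1 = L_0^2,\quad F_0+1 = L_1^2, \quad F_3^3+1 = F_6+1 = L_2^2,\quad F_4F_5+1 = L_3^2, \\ &F_3^4F_4+1 = F_3F_4F_6+1 = L_4^2, \quad F_4F_5F_6 + 1 = F_3^3F_4F_5+1 = L_5^2, \\ &F_3^3F_5F_8 + 1 = L_7^2,\quad F_3^4F_4^2F_5F_{10}+1 = F_3F_4^2F_5F_6F_{10}+1 = L_{11}^2,\\ &F_3^4F_4^2F_5F_{14}+1 = F_3F_4^2F_5F_6F_{14}+1 = L_{13}^2, \end{align*} together with the infinite family $F_5F_{m-1}F_{m+1}+1 = L_m^2$ for every odd number $m\geq 7$.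
   Context: $(F_n)_{n\ge 0}$ is the Fibonacci sequence: $F_0=0$, $F_1=1$, $F_n=F_{n-1}+F_{n-2}$ for $n\ge 2$. $(L_n)_{n\ge 0}$ is the Lucas sequence: $L_0=2$, $L_1=1$, $L_n=L_{n-1}+L_{n-2}$ for $n\ge 2$. A solution is a tuple $(m,k,n_1,\dots,n_k)$; the indices $n_i$ need not be distinct, and in a displayed solution a power $F_n^a$ means that the index $n$ occurs $a$ times among $n_1,\dots,n_k$ (so each displayed product, with factors sorted by index, specifies a tuple). A solution is called nontrivial if either $k=1$, or $k\geq 2$ and $n_1\geq 3$. *)

(* Defs.v *)
From mathcomp Require Import all_boot.

Set Implicit Arguments.
Unset Strict Implicit.
Unset Printing Implicit Defensive.

Fixpoint fib (n : nat) : nat :=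
  match n with
  | 0 => 0
  | 1 => 1
  | (n2.+1 as n1).+1 => fib n1 + fib n2
  end.

Fixpoint lucas (n : nat) : nat :=
  match n with
  | 0 => 2
  | 1 => 1
  | (n2.+1 as n1).+1 => lucas n1 + lucas n2
  end.

(* The tuple (m, k, n_1, ..., n_k) is encoded by m and the sequence
   s = [:: n_1; ...; n_k], with k = size s. *)
Definition is_solution (m : nat) (s : seq nat) : Prop :=
  [/\ 1 <= size s, sorted leq s & (\prod_(n <- s) fib n) + 1 = lucas m ^ 2].

(* The first entry of s is n_1; the default value 0 of head is never used, as
   head is only consulted when s is nonempty. *)
Definition nontrivial (s : seq nat) : Prop :=
  size s = 1 \/ (2 <= size s /\ 3 <= head 0 s).

(* In each entry (m, s), nseq a n stands for a power F_n^a in the product. *)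
Definition sporadic_solutions : seq (nat * seq nat) :=
  [:: (0, [:: 4]);
      (1, [:: 0]);
      (2, nseq 3 3);
      (2, [:: 6]);
      (3, [:: 4; 5]);
      (4, nseq 4 3 ++ [:: 4]);
      (4, [:: 3; 4; 6]);
      (5, [:: 4; 5; 6]);
      (5, nseq 3 3 ++ [:: 4; 5]);
      (7, nseq 3 3 ++ [:: 5; 8]);
      (11, nseq 4 3 ++ nseq 2 4 ++ [:: 5; 10]);
      (11, [:: 3] ++ nseq 2 4 ++ [:: 5; 6; 10]);
      (13, nseq 4 3 ++ nseq 2 4 ++ [:: 5; 14]);
      (13, [:: 3] ++ nseq 2 4 ++ [:: 5; 6; 14])].

(* Main.v *)
(** The products are controlled by primitive prime divisors. For m even,
    L_m^2 - 1 = F_{3m} / F_m, and for m odd, L_m^2 - 1 = 5 F_{m-1} F_{m+1}. A prime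
    that divides F_n and no earlier term divides F_k only when n divides k; with
    n = 3m this makes the product at least F_{3m}, which is too large, and with
    n = m + 1, then n = m - 1, it forces the indices m + 1 and m - 1 to occur and
    leaves the product 5. The cases m <= 13 are a finite search.

    Such primes exist for every even n > 12 (a case of Carmichael's theorem). Let
    D be the absolute value of the resultant of the n-th cyclotomic polynomial
    and X^2 + 3X + 1, whose roots are the ratios -phi^2 and -phi^-2 of the
    conjugates; it divides (F_n / F_{n/r})^2 for every prime r dividing n.
    If every prime dividing F_n divides an earlier term, then D divides p^2 for a single prime p
    dividing n. On the other hand, for n = p^{k+1} z with p not dividing z,
    Phi_n(X) = Phi_z(X^{p^{k+1}}) / Phi_z(X^{p^k}), and bounding the factors
    |x - w| with |w| = 1 trivially already gives D > p^2. *)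
Require Import Defs.
From Stdlib Require Import NArith.
From mathcomp Require Import all_boot all_order all_algebra all_field zify ring.

Set Implicit Arguments.
Unset Strict Implicit.
Unset Printing Implicit Defensive.

(** * Fibonacci and Lucas numbers *)

Lemma fibSS n : fib n.+2 = fib n.+1 + fib n.
Proof. by []. Qed.

Lemma lucasSS n : lucas n.+2 = lucas n.+1 + lucas n.
Proof. by []. Qed.

Lemma fibDS m n : fib (m.+1 + n) = fib m.+1 * fib n.+1 + fib m * fib n.
Proof.
elim: m n => [|m IH] n; first by rewrite mul1n mul0n addn0.
by rewrite addSnnS IH !fibSS; lia.
Qed.

Lemma fib_gt0 n : 0 < n -> 0 < fib n.
Proof. by case: n => // n _; elim: n => // n IH; rewrite fibSS ltn_addr. Qed.

Lemma leq_fib : {homo fib : m n / m <= n}.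
Proof.
apply: (homo_leq (leqnn) leq_trans) => -[|n] //.
by rewrite fibSS leq_addr.
Qed.

Lemma fib_gt1 n : 2 < n -> 1 < fib n.
Proof. by move=> n3; apply: leq_trans (leq_fib n3). Qed.

Lemma lucasS n : lucas n.+1 = fib n + fib n.+2.
Proof.
suff [] : lucas n.+1 = fib n + fib n.+2 /\ lucas n.+2 = fib n.+1 + fib n.+3 by [].
by elim: n => // n [IH1 IH2]; split; rewrite // lucasSS IH1 IH2 !fibSS; lia.
Qed.

Lemma coprime_fibS n : coprime (fib n) (fib n.+1).
Proof.
elim: n => // n IH.
by rewrite fibSS coprime_sym /coprime gcdnC gcdnDl gcdnC.
Qed.

Lemma dvdn_fibDl d m n : d %| fib m -> (d %| fib (m + n)) = (d %| fib n).
Proof.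
case: m => // m dm; rewrite fibDS (dvdn_addr _ (dvdn_mulr _ dm)) Gauss_dvdr //.
by apply: coprime_dvdl dm _; rewrite coprime_sym coprime_fibS.
Qed.

(** Subtractive Euclidean algorithm on the indices, driven by [dvdn_fibDl]. *)
Lemma dvdn_fib_gcd d m n : d %| fib m -> d %| fib n -> d %| fib (gcdn m n).
Proof.
have [k] := ubnP (m + n); elim: k m n => // k IH m n lt_mnk dm dn.
wlog le_mn : m n lt_mnk dm dn / m <= n.
  move=> W; case/orP: (leq_total m n) => [/W|/W]; first exact.
  by rewrite gcdnC; apply=> //; rewrite addnC.
case: (posnP m) dm => [-> _|m0 dm]; first by rewrite gcd0n.
rewrite -(subnKC le_mn) gcdnDl; apply: IH => //; first by lia.
by rewrite -(dvdn_fibDl _ dm) subnKC.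
Qed.

Lemma dvdn_fib m n : m %| n -> fib m %| fib n.
Proof.
case/dvdnP=> k ->; elim: k => // k IH.
by rewrite mulSn dvdn_fibDl.
Qed.

Lemma fib_mul_expand m r : 0 < r -> let x := fib m.+1 in let y := fib m in
  exists g u v, [/\ fib (r * m.+1) = x * g, fib (r * m.+1).-1 = y ^ r + x ^ 2 * u
    & y ^ 2 * g = r * y ^ r.+1 + 'C(r, 2) * x * y ^ r + x ^ 2 * v].
Proof.
move=> r0 x y; case: r r0 => // r _; elim: r => [|r [g [u [v [E1 E2 E3]]]]].
  by exists 1, 0, 0; rewrite bin_small // mul1n /= expn1 !muln0 !mul0n !addn0 !muln1 mul1n.
set k := (r.+1 * m.+1).-1 in E2.
have Ek : r.+1 * m.+1 = k.+1 by rewrite /k prednK.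
rewrite Ek in E1.
have E4 : fib (r.+2 * m.+1) = fib k.+1 * fib m.+2 + fib k * fib m.+1.
  by rewrite -fibDS -Ek; congr fib; lia.
have E5 : fib (r.+2 * m.+1).-1 = fib k.+1 * fib m.+1 + fib k * fib m.
  by rewrite -fibDS -Ek; congr fib; lia.
rewrite E4 E5 E1 E2 fibSS -/x -/y binS bin1.
exists (g * (x + y) + y ^ r.+1 + x ^ 2 * u), (g + u * y).
exists ('C(r.+1, 2) * y ^ r.+1 + (x + y) * v + u * y ^ 2).
split.
- by ring.
- by rewrite !expnS; ring.
- transitivity (y ^ 2 * g * (x + y) + y ^ 2 * (y ^ r.+1 + x ^ 2 * u)); first by ring.
  rewrite E3 !expnS; ring.
Qed.

Lemma lucas_gt0 n : 0 < lucas n.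
Proof.
suff /andP[] : (0 < lucas n) && (0 < lucas n.+1) by [].
by elim: n => // n /andP[IH1 IH2]; rewrite IH2 lucasSS ltn_addr.
Qed.

Lemma lucas_gt1 n : n != 1 -> 1 < lucas n.
Proof.
case: n => [|[|n]] // _; rewrite lucasSS.
by have := lucas_gt0 n; have := lucas_gt0 n.+1; lia.
Qed.

Lemma leq_lucas m n : 0 < m -> m <= n -> lucas m <= lucas n.
Proof.
move=> m0 /subnKC <-; elim: (n - m) => [|k IH]; first by rewrite addn0.
apply: leq_trans IH _; case: m m0 => // m _.
by rewrite addSn addnS lucasSS leq_addr.
Qed.

Lemma lucasDS m n : lucas (m.+1 + n) = fib n.+1 * lucas m.+1 + fib n * lucas m.
Proof.
elim: n m => [|n IH] m; first by rewrite addn0 mul1n mul0n addn0.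
by rewrite addnS -addSn IH lucasSS fibSS; lia.
Qed.

(** L_(j+i) >= F_(i+1) L_j, and L_j >= 3 absorbs the additive constants: c (L_j + 2) + 2 < (5c + 3)
    L_j / 3. *)
Lemma lucas_gap c i j p : 1 < j -> j + i <= p * j -> 5 * c + 3 <= 3 * fib i.+1 ->
  c * (lucas j + 2) < lucas (p * j) - 2.
Proof.
move=> j1 le_jp cF; have j0 : 0 < j by lia.
have L3 : 3 <= lucas j := leq_lucas (isT : 0 < 2) j1.
have : fib i.+1 * lucas j <= lucas (p * j).
  apply: leq_trans (leq_lucas _ le_jp); last by lia.
  by rewrite -(prednK j0) lucasDS leq_addr.
nia.
Qed.

(** Provides the hypothesis of [lucas_gap] with c = p^2 and i = 2(p - 1), for primes p = q + 1 >=
    7. *)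
Lemma fib_gt_sq q : 6 <= q -> 5 * q.+1 ^ 2 + 3 <= 3 * fib q.*2.+1.
Proof.
elim: q => // q IH; rewrite leq_eqVlt => /predU1P[<- //| lt6q].
move: (IH lt6q); rewrite doubleS !fibSS; set a := fib _; set b := fib _.
by rewrite !expnS expn0; nia.
Qed.

(** Modulo x = F_m the expansion reads y^2 g = r y^(r+1), and q is prime to y = F_(m-1). *)
Lemma dvdn_fib_quotient m r q : 0 < m -> 0 < r -> prime q -> q %| fib m ->
  q %| fib (r * m) %/ fib m -> q %| r.
Proof.
case: m => // m _ r0 q_pr qx.
have [g [u [v [-> _ E]]]] := fib_mul_expand m r0.
rewrite mulKn ?fib_gt0 // => qg.
have qy : coprime q (fib m).
  by apply: coprime_dvdl qx _; rewrite coprime_sym coprime_fibS.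
have : q %| fib m ^ 2 * g by rewrite dvdn_mull.
rewrite E (dvdn_addl _ (dvdn_mulr _ (dvdn_exp _ qx))) //.
rewrite (dvdn_addl _ (dvdn_mulr _ (dvdn_mull _ qx))).
by rewrite Gauss_dvdl ?coprimeXr.
Qed.

(** Modulo p^2 the expansion leaves y^2 g = p y^(p+1), because p divides both x and C(p, 2); for p =
    2 that coefficient is 1 and 4 | x replaces it. *)
Lemma fib_quotient_prime_sq m p : 0 < m -> prime p -> p %| fib m ->
  (p = 2 -> 4 %| fib m) -> ~~ (p ^ 2 %| fib (p * m) %/ fib m).
Proof.
case: m => // m _ p_pr px p2x; have p0 := prime_gt0 p_pr.
have [g [u [v [-> _ E]]]] := fib_mul_expand m p0.
rewrite mulKn ?fib_gt0 //; apply/negP => pg.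
have py : coprime p (fib m).
  by apply: coprime_dvdl px _; rewrite coprime_sym coprime_fibS.
have : p ^ 2 %| fib m ^ 2 * g by rewrite dvdn_mull.
rewrite E (dvdn_addl _ (dvdn_mulr _ (dvdn_exp2r _ px))) //.
rewrite dvdn_addl; last first.
  apply: dvdn_mulr; case: (ltngtP p 2) => [| p_gt2 | p2].
  - by have := prime_gt1 p_pr; lia.
  - by rewrite expnS expn1 dvdn_mul // prime_dvd_bin.
  - by apply: dvdn_mull; move: (p2x p2); rewrite p2.
rewrite expnS expn1 dvdn_pmul2l // => pyp.
have : coprime p p by apply: coprime_dvdr pyp _; rewrite coprimeXr.
by rewrite /coprime gcdnn => /eqP p1; rewrite p1 in p_pr.
Qed.

(** p divides F_g for g = gcd(n, j), a proper divisor of n, and g divides n / r for every prime r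
    dividing n / g. *)
Lemma nonprimitive_prime n p j : 0 < j < n -> p %| fib n -> p %| fib j ->
  exists r, [/\ prime r, r %| n & p %| fib (n %/ r)].
Proof.
case/andP=> j0 jn pn pj.
have pg := dvdn_fib_gcd pn pj; set g := gcdn n j in pg.
have gn : g %| n := dvdn_gcdl n j.
have g0 : 0 < g by rewrite gcdn_gt0 j0 orbT.
have lt_gn : g < n by apply: leq_ltn_trans jn; exact: dvdn_leq (dvdn_gcdr _ _).
have q1 : 1 < n %/ g by rewrite ltn_divRL // mul1n.
exists (pdiv (n %/ g)); split; first exact: pdiv_prime.
  by apply: dvdn_trans (pdiv_dvd _) (dvdn_div gn).
apply: dvdn_trans pg _; apply: dvdn_fib.
have /dvdnP[c Ec] := pdiv_dvd (n %/ g).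
have En : n = c * g * pdiv (n %/ g) by rewrite -{1}(divnK gn) {1}Ec mulnAC.
by rewrite {1}En mulnK ?pdiv_gt0 // dvdn_mull.
Qed.

(* Pigeonhole on the ratios F_{i+2} / F_{i+1} modulo p. *)
Lemma fib_rank_leq p : prime p -> exists2 z, 0 < z <= p.+1 & p %| fib z.
Proof.
move=> p_pr; pose F i : 'F_p := ((fib i)%:R)%R.
have F0 i : (F i == 0)%R = (p %| fib i) by rewrite (GRing.dvdn_pcharf (pchar_Fp p_pr)).
have FSS i : F i.+2 = (F i.+1 + F i)%R by rewrite /F -GRing.natrD.
case: (boolP [exists i : 'I_p.+1, p %| fib i.+1]) => [/existsP[i pi] | ].
  by exists i.+1 => //; rewrite ltn_ord.
rewrite negb_exists => /forallP nz.
(* d'Ocagne's identity modulo p, by descent on i *)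
have shift i d : (F i.+1 * F (i + d)%N = F (i + d)%N.+1 * F i)%R -> p %| fib d.
  rewrite -F0; elim: i => [|i IH].
    by rewrite add0n /= GRing.mulr0 GRing.mul1r => ->.
  rewrite addSn !FSS => E; apply: IH.
  have: (F (i + d)%N.+1 * F i - F i.+1 * F (i + d)%N = 0)%R.
    by rewrite -[RHS](GRing.subrr ((F i.+1 + F i) * F (i + d).+1))%R {2}E; ring.
  by move/eqP; rewrite GRing.subr_eq0 => /eqP.
pose f (i : 'I_p.+1) : 'F_p := (F i.+2 / F i.+1)%R.
have /injectivePn[i [j neq_ij Eij]] : ~~ injectiveb f.
  apply/negP => /injectiveP /leq_card; rewrite card_ord card_Fp //; lia.
wlog lt_ij : i j neq_ij Eij / i < j.
  move=> W; case: (ltngtP i j) => [| |/val_inj E]; first exact: W.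
    by apply: W; rewrite // eq_sym.
  by rewrite E eqxx in neq_ij.
have Fi := nz i; have Fj := nz j; rewrite -F0 in Fi; rewrite -F0 in Fj.
exists (j - i); first by have := ltn_ord j; lia.
have Ej : i.+1 + (j - i) = j.+1 by rewrite addSn subnKC // ltnW.
apply: (shift i.+1); rewrite Ej.
move: Eij; rewrite /f => /eqP; rewrite GRing.eqr_div // => /eqP E.
by rewrite E.
Qed.

(** * Cyclotomic polynomials at the squared golden ratio *)

Import Order.TTheory GRing.Theory Num.Theory.

Local Notation pZtoC := (map_poly (intr : int -> algC)).

(** Proved jointly: the induction step eliminates (-1)^n by the third identity, Cassini's. *)
Lemma lucas_double n :
  [/\ (lucas n.*2)%:Z = 5 * (fib n)%:Z ^+ 2 + 2 * (-1) ^+ n,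
      (lucas n.*2.+1)%:Z = 5 * (fib n)%:Z * (fib n.+1)%:Z + (-1) ^+ n &
      (fib n.+1)%:Z ^+ 2 - (fib n)%:Z * (fib n.+1)%:Z - (fib n)%:Z ^+ 2
      = (-1) ^+ n]%R.
Proof.
elim: n => [|n [IH1 IH2 IH3]]; first by [].
rewrite doubleS [((-1) ^+ n.+1)%R]exprS.
have L2 : ((lucas n.*2.+2)%:Z = (lucas n.*2.+1)%:Z + (lucas n.*2)%:Z)%R.
  by rewrite lucasSS PoszD.
have L3 : ((lucas n.*2.+3)%:Z = 2 * (lucas n.*2.+1)%:Z + (lucas n.*2)%:Z)%R.
  by rewrite lucasSS PoszD L2; ring.
have F2 : ((fib n.+2)%:Z = (fib n.+1)%:Z + (fib n)%:Z)%R by rewrite fibSS PoszD.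
rewrite L2 L3 F2 IH1 IH2 -IH3; move: (Posz (fib n)) (Posz (fib n.+1)) => x y.
by split; ring.
Qed.

(** Induction on z: over all d dividing z, both sides multiply to X^(p^(k+1) z) - 1, and the factors
    at proper divisors cancel. *)
Lemma Cyclotomic_expand p k z : prime p -> ~~ (p %| z) ->
  ('Phi_(p ^ k.+1 * z) * ('Phi_z \Po 'X^(p ^ k)) = 'Phi_z \Po 'X^(p ^ k.+1))%R.
Proof.
move=> p_pr; elim/ltn_ind: z => z IH pz.
have z0 : 0 < z by case: z pz {IH} => //; rewrite dvdn0.
have p0 := prime_gt0 p_pr.
have div0 m : 0 < p ^ m * z by rewrite muln_gt0 expn_gt0 p0.
have compX m : ('X^m \Po 'X^z = 'X^(z * m) :> {poly int})%R.
  by rewrite comp_Xn_poly exprM.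
have prodX m : (\prod_(d <- divisors z) ('Phi_d \Po 'X^m) = 'X^(m * z) - 1 :> {poly int})%R.
  rewrite -rmorph_prod /= prod_Cyclotomic // rmorphB /= rmorph1 comp_Xn_poly.
  by rewrite exprM.
(* A divisor of p^(k+1) z either divides p^k z or contains the full power p^(k+1). *)
have split_div : perm_eq (divisors (p ^ k.+1 * z))
    (divisors (p ^ k * z) ++ [seq p ^ k.+1 * d | d <- divisors z]).
  have pkz d : d %| z -> ~~ (p ^ k.+1 * d %| p ^ k * z).
    move=> dz; rewrite expnS -mulnA mulnCA dvdn_pmul2l ?expn_gt0 ?p0 //.
    by apply: contra pz; apply: dvdn_trans; apply: dvdn_mulr.
  apply: uniq_perm; first exact: divisors_uniq.
    rewrite cat_uniq divisors_uniq map_inj_uniq ?divisors_uniq; last first.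
      by move=> x y /eqP; rewrite eqn_pmul2l ?expn_gt0 ?p0 // => /eqP.
    rewrite andbT; apply/hasPn => _ /mapP[d dz ->].
    rewrite -dvdn_divisors //; apply: pkz.
    by rewrite dvdn_divisors.
  move=> d; rewrite mem_cat -!dvdn_divisors //; apply/idP/orP.
    move=> dn; case: (boolP (d %| p ^ k * z)) => [|nd]; [by left | right].
    have d0 : 0 < d := dvdn_gt0 (div0 k.+1) dn.
    case: (boolP (p ^ k.+1 %| d)) => [/dvdnP[e de] | npd].
      apply/mapP; exists e; last by rewrite mulnC.
      rewrite -dvdn_divisors // -(@dvdn_pmul2l (p ^ k.+1)) ?expn_gt0 ?p0 //.
      by rewrite mulnC -de.
    case/negP: nd.
    have [l pl Ed] := pfactor_coprime p_pr d0.
    have lk : logn p d <= k by rewrite leqNgt -pfactor_dvdn.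
    rewrite Ed mulnC dvdn_mul ?dvdn_exp2l //.
    have ln : l %| p ^ k.+1 * z by apply: dvdn_trans dn; rewrite Ed dvdn_mulr.
    by move: ln; rewrite Gauss_dvdr // coprime_sym coprimeXl.
  case=> [dn|/mapP[e]].
    by apply: dvdn_trans dn _; rewrite dvdn_mul // dvdn_exp2l.
  by rewrite -dvdn_divisors // => ez ->; rewrite dvdn_mul.
have key : (\prod_(d <- divisors z)
    ('Phi_(p ^ k.+1 * d) * ('Phi_d \Po 'X^(p ^ k)))
    = \prod_(d <- divisors z) ('Phi_d \Po 'X^(p ^ k.+1)))%R.
  rewrite big_split /= !prodX -[in RHS]prod_Cyclotomic //.
  rewrite (perm_big _ split_div) big_cat /= big_map prod_Cyclotomic //.
  by rewrite mulrC.
have z_in : z \in divisors z by rewrite -dvdn_divisors.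
rewrite (big_rem z) //= [RHS](big_rem z) //= in key.
have rem_eq : (\prod_(d <- rem z (divisors z))
    ('Phi_(p ^ k.+1 * d) * ('Phi_d \Po 'X^(p ^ k)))
    = \prod_(d <- rem z (divisors z)) ('Phi_d \Po 'X^(p ^ k.+1)))%R.
  apply: eq_big_seq => d; rewrite mem_rem_uniq ?divisors_uniq // !inE.
  rewrite -dvdn_divisors // => /andP[dz ddz]; apply: IH.
    by rewrite ltn_neqAle dz dvdn_leq.
  by apply: contra pz => /dvdn_trans; apply.
rewrite rem_eq in key; apply: (mulIf _ key).
have nz m : (0 < m)%N -> (\prod_(d <- divisors z) ('Phi_d \Po 'X^m) != 0 :> {poly int})%R.
  move=> m0; rewrite prodX monic_neq0 // monicXnsubC // muln_gt0 m0; exact: z0.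
have := nz (p ^ k.+1); rewrite expn_gt0 p0 => /(_ isT).
by rewrite (big_rem z) //= mulf_eq0 negb_or => /andP[].
Qed.

(** The square of the golden ratio, with conjugate [phi2^-1]. *)
Definition phi2 : algC := ((3 + sqrtC 5) / 2)%R.

Lemma phi2_ge1 : (1 <= phi2)%R.
Proof.
rewrite /phi2 ler_pdivlMr // mul1r.
have s0 : (0 <= sqrtC 5 :> algC)%R by rewrite sqrtC_ge0.
apply: (@le_trans _ _ (3 + 0)%R); last by rewrite lerD2l.
by rewrite addr0 ler_nat.
Qed.

Lemma phi2_neq0 : (phi2 != 0)%R.
Proof. by rewrite gt_eqF // (lt_le_trans ltr01 phi2_ge1). Qed.

Lemma phi2D_inv : (phi2 + phi2^-1 = 3)%R.
Proof.
apply: (mulfI phi2_neq0); rewrite mulrDr mulfV ?phi2_neq0 //.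
have s5 : (sqrtC 5 * sqrtC 5 = 5 :> algC)%R by rewrite -expr2 sqrtCK.
by rewrite /phi2; field: s5.
Qed.

Lemma phi2_lucas n : (phi2 ^+ n + phi2^-1 ^+ n = (lucas n.*2)%:R)%R.
Proof.
suff [] : (phi2 ^+ n + phi2^-1 ^+ n = (lucas n.*2)%:R)%R /\
  (phi2 ^+ n.+1 + phi2^-1 ^+ n.+1 = (lucas n.+1.*2)%:R)%R by [].
elim: n => [|n [IH1 IH2]]; first by split; rewrite ?expr0 ?expr1 ?phi2D_inv.
split=> //.
have -> : (phi2 ^+ n.+2 + phi2^-1 ^+ n.+2
    = (phi2 ^+ n.+1 + phi2^-1 ^+ n.+1) * (phi2 + phi2^-1)
      - (phi2 ^+ n + phi2^-1 ^+ n))%R.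
  rewrite !exprS; field; exact: phi2_neq0.
rewrite IH1 IH2 phi2D_inv; apply/eqP.
rewrite subr_eq -natrM -natrD eqr_nat; apply/eqP.
by rewrite !doubleS !lucasSS; lia.
Qed.

(* For integral p this is, up to sign, the resultant of p and X^2 + 3X + 1. *)
Definition phi2_resultant (p : {poly int}) : algC :=
  ((pZtoC p).[- phi2] * (pZtoC p).[- phi2^-1])%R.

Lemma phi2_resultantM p q : (`|phi2_resultant (p * q)|
  = `|phi2_resultant p| * `|phi2_resultant q|)%R.
Proof. by rewrite -normrM /phi2_resultant rmorphM /= !hornerM mulrACA. Qed.

(** Modulo X^2 + 3X + 1 the polynomial reduces to u + vX, whose resultant is the integer u^2 - 3uv +
    v^2. *)
Lemma phi2_resultant_nat p : exists D : nat, (`|phi2_resultant p| = D%:R)%R.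
Proof.
have [u [v E]] : exists u v : int, forall t : algC, (t ^+ 2 + 3 * t + 1 = 0 ->
    (pZtoC p).[t] = u%:~R + v%:~R * t)%R.
  elim/poly_ind: p => [|p c [u [v IH]]].
    by exists 0%R, 0%R => t _; rewrite rmorph0 horner0 mul0r addr0.
  exists (c - v)%R, (u - 3 * v)%R => t t0.
  rewrite rmorphD rmorphM /= map_polyX map_polyC /= hornerMXaddC IH //.
  have -> : ((u%:~R + v%:~R * t) * t + c%:~R = (c%:~R - v%:~R)
     + (u%:~R - 3 * v%:~R) * t + v%:~R * (t ^+ 2 + 3 * t + 1))%R by ring.
  by rewrite t0 mulr0 addr0 !intrB intrM.
have root (t : algC) : (t != 0 -> t + t^-1 = 3 -> (- t) ^+ 2 + 3 * - t + 1 = 0)%R.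
  by move=> t0 <-; field.
have nz := phi2_neq0; have inv3 := phi2D_inv.
have Ez : phi2_resultant p = ((u ^+ 2 - 3 * u * v + v ^+ 2)%:~R)%R.
  have -> : ((u ^+ 2 - 3 * u * v + v ^+ 2)%:~R = u%:~R ^+ 2
      - 3 * u%:~R * v%:~R + v%:~R ^+ 2 :> algC)%R.
    by rewrite intrD intrB !intrM.
  rewrite /phi2_resultant (E _ (root _ nz inv3)) E; last first.
    by apply: root; rewrite ?invr_eq0 // invrK addrC.
  by rewrite -inv3; field.
exists `|(u ^+ 2 - 3 * u * v + v ^+ 2)%R|%N.
by rewrite Ez -intr_norm -abszE.
Qed.

(** The product of the two values is 2 - (-1)^m L_(2m), and L_(2m) = 5 F_m^2 + 2 (-1)^m. *)
Lemma phi2_resultant_Xn_sub1 m : (`|phi2_resultant ('X^m - 1)| = 5 * (fib m)%:R ^+ 2)%R.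
Proof.
have nz := phi2_neq0.
have -> : (phi2_resultant ('X^m - 1) = 2 - (-1) ^+ m * (phi2 ^+ m + phi2^-1 ^+ m))%R.
  rewrite /phi2_resultant rmorphB rmorph1 /= map_polyXn !hornerE.
  rewrite [((- phi2) ^+ m)%R]exprNn [((- phi2^-1) ^+ m)%R]exprNn.
  have := signrMK m (1 : algC)%R; rewrite mulr1 => s2.
  have p2 : (phi2 ^+ m * phi2^-1 ^+ m = 1)%R by rewrite -exprMn mulfV // expr1n.
  have -> : (((-1) ^+ m * phi2 ^+ m - 1) * ((-1) ^+ m * phi2^-1 ^+ m - 1)
    = (-1) ^+ m * (-1) ^+ m * (phi2 ^+ m * phi2^-1 ^+ m) + 1
      - (-1) ^+ m * (phi2 ^+ m + phi2^-1 ^+ m) :> algC)%R by ring.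
  by rewrite s2 p2 mulr1.
have [L _ _] := lucas_double m.
have {L} : ((lucas m.*2)%:R = 5 * (fib m)%:R ^+ 2 + 2 * (-1) ^+ m :> algC)%R.
  have := congr1 (intr : int -> algC) L.
  by rewrite intrD !intrM !rmorphXn /= rmorphN1.
rewrite phi2_lucas => ->.
have ss : ((-1) ^+ m * (-1) ^+ m = 1 :> algC)%R by rewrite -expr2 sqrr_sign.
have -> : (2 - (-1) ^+ m * (5 * (fib m)%:R ^+ 2 + 2 * (-1) ^+ m)
    = - ((-1) ^+ m * (5 * (fib m)%:R ^+ 2)) :> algC)%R by ring: ss.
by rewrite normrN normrMsign !normrM !normr_nat.
Qed.

(** Each root of unity w contributes |a - w| |b - w| with |a| = phi2^j and |b| = phi2^-j. The
    triangle inequality encloses this between (phi2^j - 1)(1 - phi2^-j) = L_(2j) - 2 and (phi2^j +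
    1)(1 + phi2^-j) = L_(2j) + 2. *)
Lemma phi2_resultant_Cyclotomic_comp z j : 0 < z ->
  ((((lucas j.*2) - 2) ^ totient z)%:R <= `|phi2_resultant ('Phi_z \Po 'X^j)|
    <= ((lucas j.*2 + 2) ^ totient z)%:R)%R.
Proof.
move=> z0; have [w w_prim] := C_prim_root_exists z0.
have nz := phi2_neq0; have ge1 := phi2_ge1.
have pos : (0 <= phi2)%R := le_trans ler01 ge1.
have L : (phi2 ^+ j * phi2^-1 ^+ j = 1)%R by rewrite -exprMn mulfV // expr1n.
have evalX t : ((pZtoC ('Phi_z \Po 'X^j)).[t]
    = \prod_(k < z | coprime k z) (t ^+ j - w ^+ k))%R.
  rewrite map_comp_poly /= map_polyXn horner_comp hornerXn.
  rewrite (Cintr_Cyclotomic w_prim) horner_prod.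
  by apply: eq_bigr => k _; rewrite hornerXsubC.
have normw k : (`|w ^+ k| = 1)%R.
  have : (`|w| ^+ z == 1)%R by rewrite -normrX (prim_expr_order w_prim) normr1.
  by rewrite pexpr_eq1 // -?lt0n // => /eqP w1; rewrite normrX w1 expr1n.
have card_prod (x : algC) :
    (\prod_(k < z | coprime k z) x = x ^+ totient z)%R.
  rewrite prodr_const; congr (_ ^+ _)%R.
  rewrite totient_count_coprime -big_mkcond big_mkord -sum1_card.
  by apply: eq_bigl => k; rewrite coprime_sym.
have normN (t : algC) : (0 <= t -> `|(- t) ^+ j| = t ^+ j)%R.
  by move=> t0; rewrite normrX normrN ger0_norm.
have A1 : (1 <= phi2 ^+ j)%R by rewrite exprn_ege1.
have B0 : (0 <= phi2^-1 ^+ j)%R by rewrite exprn_ge0 // invr_ge0.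
have B1 : (phi2^-1 ^+ j <= 1)%R
  by rewrite exprn_ile1 ?invr_ge0 // invf_le1 // (lt_le_trans ltr01).
(* Keeps the truncated subtraction exact; the even index 2j differs from 1. *)
have L2 : 2 <= lucas j.*2.
  by apply: lucas_gt1; rewrite -(odd_double_half 1) /=; lia.
rewrite /phi2_resultant !evalX -big_split /= normr_prod !natrX -!card_prod.
rewrite natrB // natrD -phi2_lucas.
have lowE : (phi2 ^+ j + phi2^-1 ^+ j - 2 = (phi2 ^+ j - 1) * (1 - phi2^-1 ^+ j))%R.
  by rewrite -[2%R]/(1 + 1)%R -{1}L; ring.
have highE : (phi2 ^+ j + phi2^-1 ^+ j + 2 = (phi2 ^+ j + 1) * (1 + phi2^-1 ^+ j))%R.
  by rewrite -[2%R]/(1 + 1)%R -{1}L; ring.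
rewrite lowE highE.
apply/andP; split; apply: ler_prod => k _; rewrite normrM; apply/andP; split.
- by rewrite mulr_ge0 // subr_ge0.
- apply: ler_pM; rewrite ?subr_ge0 //.
    by rewrite -(normN _ pos) -[1%R](normw k) lerB_dist.
  rewrite distrC -(normN phi2^-1)%R ?invr_ge0 // -[1%R](normw k); exact: lerB_dist.
- by rewrite mulr_ge0.
- apply: ler_pM => //.
    by rewrite -(normN _ pos) -[1%R](normw k) ler_normB.
  by rewrite distrC -(normN phi2^-1)%R ?invr_ge0 // -[1%R](normw k) ler_normB.
Qed.

(** * Primitive prime divisors *)

(** D is the resultant of Phi_n in absolute value. Taking resultants in X^n - 1 = Phi_n (X^(n/r) -
    1) Q gives the first property; [Cyclotomic_expand] and the two-sided bounds give the second. *)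
Lemma Cyclotomic_resultant n : 0 < n -> exists D,
  (forall r, prime r -> r %| n -> D * fib (n %/ r) ^ 2 %| fib n ^ 2) /\
  (forall p k z, prime p -> ~~ (p %| z) -> n = p ^ k.+1 * z ->
    (lucas (p ^ k.+1).*2 - 2) ^ totient z
      <= D * (lucas (p ^ k).*2 + 2) ^ totient z).
Proof.
move=> n0; have [D ED] := phi2_resultant_nat 'Phi_n; exists D; split.
  move=> r r_pr rn; set m := n %/ r.
  have r0 := prime_gt0 r_pr.
  have m0 : 0 < m by rewrite divn_gt0 // dvdn_leq.
  have mn : m %| n by rewrite dvdn_div.
  have nm : ~~ (n %| m).
    by rewrite gtnNdvd // ltn_Pdiv // prime_gt1.
  have [Q EQ] : exists Q : {poly int},
      ('X^n - 1 = 'Phi_n * ('X^m - 1) * Q :> {poly int})%R.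
    exists (\prod_(d <- rem n [seq d <- divisors n | ~~ (d %| m)%N]) 'Phi_d)%R.
    rewrite -(prod_Cyclotomic n0) (bigID (fun d => d %| m)%N) /=.
    rewrite -mulrA mulrCA; congr (_ * _)%R.
      rewrite -(prod_Cyclotomic m0) -big_filter; apply: perm_big.
      apply: uniq_perm; rewrite ?filter_uniq ?divisors_uniq // => d.
      rewrite mem_filter -!dvdn_divisors //.
      by case dm: (d %| m); rewrite //= (dvdn_trans dm).
    rewrite -big_filter (big_rem n) //=.
    by rewrite mem_filter nm -dvdn_divisors //=.
  have [q Eq] := phi2_resultant_nat Q.
  have : (`|phi2_resultant ('X^n - 1)| = (D * (5 * fib m ^ 2) * q)%:R)%R.
    by rewrite EQ !phi2_resultantM ED Eq phi2_resultant_Xn_sub1 !natrM.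
  rewrite phi2_resultant_Xn_sub1 -!natrX -!natrM => /eqP; rewrite eqr_nat => /eqP E.
  apply/dvdnP; exists q; apply/eqP; rewrite -(@eqn_pmul2l 5) // E.
  by apply/eqP; ring.
move=> p k z p_pr pz En.
have z0 : 0 < z by case: z pz {En} => //; rewrite dvdn0.
have E : (D%:R * `|phi2_resultant ('Phi_z \Po 'X^(p ^ k))|
    = `|phi2_resultant ('Phi_z \Po 'X^(p ^ k.+1))|)%R.
  by rewrite -(Cyclotomic_expand k p_pr pz) -En phi2_resultantM ED.
have /andP[low _] := phi2_resultant_Cyclotomic_comp (p ^ k.+1) z0.
have /andP[_ high] := phi2_resultant_Cyclotomic_comp (p ^ k) z0.
rewrite -(ler_nat algC) natrM; apply: le_trans low _.
by rewrite -E ler_wpM2l.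
Qed.

(** The hypotheses make z the rank of apparition of p. If p divides F_n, it divides F_gcd(z, n), and
    minimality forces gcd(z, n) = z. *)
Lemma dvdn_fib_rank p z n : 0 < z -> p %| fib z ->
  all (fun g => ~~ (p %| fib g)) (iota 1 z.-1) -> (p %| fib n) = (z %| n).
Proof.
move=> z0 pz /allP np; apply/idP/idP => [pn | /dvdn_fib]; last exact: dvdn_trans.
have := dvdn_fib_gcd pz pn; have := dvdn_gcdr z n; have := dvdn_gcdl z n.
set g := gcdn z n => gz gn pg; have g0 := dvdn_gt0 z0 gz.
have := dvdn_leq z0 gz; rewrite leq_eqVlt => /predU1P[<- // | lt_gz].
have /np/negP : g \in iota 1 z.-1 by rewrite mem_iota; lia.
by case.
Qed.

(** The gap for a single root of unity suffices, since D <= c <= c^totient(z). *)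
Lemma Cyclotomic_resultant_gap D c p k z : 0 < z -> 0 < c -> D <= c ->
  c * (lucas (p ^ k).*2 + 2) < lucas (p ^ k.+1).*2 - 2 ->
  ~~ ((lucas (p ^ k.+1).*2 - 2) ^ totient z
      <= D * (lucas (p ^ k).*2 + 2) ^ totient z).
Proof.
move=> z0 c0 Dc gap; rewrite -ltnNge.
have t0 : 0 < totient z by rewrite totient_gt0.
apply: leq_ltn_trans (_ : (c * (lucas (p ^ k).*2 + 2)) ^ totient z < _).
  rewrite expnMn leq_mul2r (leq_trans Dc) ?orbT //.
  by rewrite -{1}(expn1 c) leq_pexp2l.
by rewrite ltn_exp2r.
Qed.

Theorem fib_primitive_divisor n : 12 < n -> ~~ odd n ->
  exists2 p, prime p & p %| fib n /\ forall j, 0 < j < n -> ~~ (p %| fib j).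
Proof.
move=> n12 n_even; have n0 : 0 < n by lia.
have fn0 : 0 < fib n := fib_gt0 n0.
pose prim p := all (fun j => ~~ (p %| fib j)) (iota 1 n.-1).
have [/hasP[p] | /hasPn imprim] := boolP (has prim (primes (fib n))).
  rewrite mem_primes => /and3P[p_pr _ pn] /allP np; exists p => //.
  by split=> // j jn; apply: np; rewrite mem_iota; lia.
have {prim} imprim p : prime p -> p %| fib n ->
    exists r, [/\ prime r, r %| n & p %| fib (n %/ r)].
  move=> p_pr pn; have := imprim p; rewrite mem_primes p_pr fn0 pn.
  move=> /(_ isT) /allPn[j]; rewrite mem_iota negbK => jn pj.
  by apply: (@nonprimitive_prime n p j) => //; lia.
exfalso; have [D [Ddvd Dlow]] := Cyclotomic_resultant n0.
have n2 : 2 %| n by rewrite dvdn2.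
have D0 : 0 < D.
  rewrite lt0n; apply/eqP => D_eq0.
  have := Ddvd 2 isT n2; rewrite D_eq0 mul0n dvd0n expn_eq0 andbT.
  by rewrite gtn_eqF.
have divr0 r : prime r -> r %| n -> 0 < n %/ r.
  by move=> r_pr rn; rewrite divn_gt0 ?prime_gt0 // dvdn_leq.
pose G r := fib (r * (n %/ r)) %/ fib (n %/ r).
have DG r : prime r -> r %| n -> D %| G r ^ 2.
  move=> r_pr rn; have := Ddvd r r_pr rn.
  have -> : fib n ^ 2 = G r ^ 2 * fib (n %/ r) ^ 2.
    rewrite -expnMn /G [r * _]mulnC divnK // divnK //.
    by apply: dvdn_fib; apply: dvdn_div.
  by rewrite dvdn_pmul2r // expn_gt0 fib_gt0 ?divr0.
(* Such a p divides F_(n/r) and, through D, also F_n / F_(n/r); by [dvdn_fib_quotient] it divides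
   r. *)
have only_p p r : prime p -> p %| D -> prime r -> r %| n ->
    p %| fib (n %/ r) -> p = r.
  move=> p_pr pD r_pr rn pr; apply/eqP; rewrite -dvdn_prime2 //.
  apply: (@dvdn_fib_quotient (n %/ r)) => //; rewrite ?divr0 ?prime_gt0 //.
  have := dvdn_trans pD (DG r r_pr rn); rewrite Euclid_dvdX //.
  by case/andP.
have Dp p : prime p -> p %| D -> p %| n /\ p %| fib (n %/ p).
  move=> p_pr pD.
  have pn : p %| fib n.
    have := dvdn_trans pD (dvdn_trans (dvdn_mulr _ (dvdnn D)) (Ddvd 2 isT n2)).
    by rewrite Euclid_dvdX // => /andP[].
  have [r [r_pr rn pr]] := imprim p p_pr pn.
  by have Ep := only_p p r p_pr pD r_pr rn pr; subst r.
(* z0 is the whole part of n prime to p: a further prime r in that part would give p | F_(n/r),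
   hence p = r. *)
have cofactor p z0 : prime p -> p %| D -> 0 < z0 -> coprime p z0 ->
    p %| fib z0 -> z0 %| n -> exists k, n = p ^ k.+1 * z0.
  move=> p_pr pD z0_gt0 pz0 pf z0n; have [pn _] := Dp p p_pr pD.
  have [z pz En] := pfactor_coprime p_pr n0.
  have : 0 < logn p n by rewrite logn_gt0 mem_primes p_pr n0 pn.
  case El : (logn p n) => [//|k] _; rewrite El in En.
  have /dvdnP[e Ee] : z0 %| z.
    by move: z0n; rewrite En Gauss_dvdl // coprime_sym coprimeXl.
  exists k; rewrite En mulnC; case: (ltngtP e 1) => e1.
  - by move: n0; rewrite En Ee; move: e1; case: e {Ee}.
  - have r_pr := pdiv_prime e1; set r := pdiv e in r_pr.
    have re : r %| e := pdiv_dvd e.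
    have rz : r %| z by rewrite Ee dvdn_mulr.
    have rn : r %| n by rewrite En dvdn_mulr.
    have Er : p = r.
      apply: only_p => //; apply: dvdn_trans pf _; apply: dvdn_fib.
      rewrite dvdn_divRL // En Ee [z0 * r]mulnC.
      by apply: dvdn_mulr; apply: dvdn_mul.
    by move: pz; rewrite Er prime_coprime // rz.
  - by rewrite Ee e1 mul1n.
have Dfib p : prime p -> p %| D -> p %| fib n.
  move=> p_pr pD; have [pn pf] := Dp p p_pr pD.
  by apply: dvdn_trans pf _; apply: dvdn_fib; apply: dvdn_div.
(* The ranks of 2 and 3 are 3 and 4; n > 12 rules out n = 6 and n = 12. *)
have D2 : 2 %| D -> exists2 k, 1 < k & n = 2 ^ k.+1 * 3.
  move=> D2; have n3 := Dfib 2 isT D2; rewrite (@dvdn_fib_rank 2 3) // in n3.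
  have [k En] := cofactor 2 3 isT D2 isT isT isT n3; exists k => //.
  by move: n12; rewrite En; case: k {En} => [|[|]].
have D3 : 3 %| D -> exists2 k, 0 < k & n = 3 ^ k.+1 * 4.
  move=> D3; have n4 := Dfib 3 isT D3; rewrite (@dvdn_fib_rank 3 4) // in n4.
  have [k En] := cofactor 3 4 isT D3 isT isT isT n4; exists k => //.
  by move: n12; rewrite En; case: k {En}.
(* The rank of 5 is 5 and n is even, so 5 | n/2 and [only_p] would give 5 = 2. *)
have D5 : ~~ (5 %| D).
  apply/negP => D5; have n5 := Dfib 5 isT D5.
  rewrite (@dvdn_fib_rank 5 5) // in n5.
  suff : 5 %| fib (n %/ 2) by move/(only_p 5 2 isT D5 isT n2).
  rewrite (@dvdn_fib_rank 5 5) // dvdn_divRL //.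
  by rewrite (@Gauss_dvd 5 2) // n5.
(* Some g <= p + 1 dividing n has p | F_g; unless q | g, also g | n/q and p = q. So q = p + 1, that
   is p = 2 and q = 3. Then n = 2^(k+1) 3 with k > 1 has 4 | n/2, so 3 | F_(n/2), against
   [only_p]. *)
have uniq_p p q : prime p -> p %| D -> prime q -> q %| D -> p < q -> False.
  move=> p_pr pD q_pr qD lt_pq.
  have [z /andP[z0 zp] pz] := fib_rank_leq p_pr.
  have pg := dvdn_fib_gcd (Dfib p p_pr pD) pz; set g := gcdn n z in pg.
  have gn : g %| n := dvdn_gcdl n z.
  have gp : g <= p.+1 by apply: leq_trans zp; exact: dvdn_leq (dvdn_gcdr _ _).
  have g0 := dvdn_gt0 n0 gn; have [qn _] := Dp q q_pr qD.
  have qg : q %| g.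
    apply: contraTT (isT) => nqg; apply/negP=> _.
    have gq : g %| n %/ q.
      by rewrite dvdn_divRL // Gauss_dvd ?gn // coprime_sym prime_coprime.
    have Epq := only_p p q p_pr pD q_pr qn (dvdn_trans pg (dvdn_fib gq)).
    by rewrite Epq ltnn in lt_pq.
  have Eq : q = p.+1.
    by apply/eqP; rewrite eqn_leq lt_pq (leq_trans (dvdn_leq g0 qg) gp).
  have p2 : p = 2.
    case: (even_prime p_pr) => // p_odd; case: (even_prime q_pr); last first.
      by rewrite Eq /= p_odd.
    by rewrite Eq => -[p1]; rewrite p1 in p_pr.
  rewrite p2 in pD; rewrite Eq p2 in qD.
  have [k k1 Ek] := D2 pD.
  suff /(only_p 3 2 isT qD isT n2) : 3 %| fib (n %/ 2) by [].
  rewrite (@dvdn_fib_rank 3 4) // Ek.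
  case: k k1 {Ek} => [|[|k]] // _.
  by rewrite expnS -mulnA mulKn // !expnS !mulnA dvdn_mulr // dvdn_mulr.
have [D1 | D_gt1] := leqP D 1.
  (* For the largest prime factor, p = 2 happens only when n is a power of 2; then n > 12 gives k >
     0, as the gap requires. *)
  pose p := max_pdiv n.
  have p_pr : prime p by apply: max_pdiv_prime; apply: leq_trans n12.
  have [z pz En] := pfactor_coprime p_pr n0.
  have : 0 < logn p n by rewrite logn_gt0 mem_primes p_pr n0 max_pdiv_dvd.
  case El : (logn p n) => [//|k] _; rewrite El mulnC in En.
  rewrite prime_coprime // in pz.
  have z0 : 0 < z by case: z pz {En} => //; rewrite dvdn0.
  have := Dlow p k z p_pr pz En; apply/negP.
  have gap2 : p = 2 -> 0 < k.
    move=> p2; case: (ltngtP z 1) => z1; first by move: z0 z1; case: (z).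
      have r_pr := pdiv_prime z1; have rz := pdiv_dvd z.
      have rn : pdiv z %| n by rewrite En dvdn_mull.
      have : pdiv z <= 2.
        by rewrite -p2; apply: max_pdiv_max; rewrite mem_primes r_pr n0.
      rewrite leq_eqVlt ltnNge prime_gt1 // orbF => /eqP r2.
      by case/negP: pz; rewrite p2 -r2.
    by move: n12; rewrite En p2 z1; case: (k).
  apply: (@Cyclotomic_resultant_gap _ 1) => //; rewrite expnS doubleMr.
  have a0 : 0 < p ^ k by rewrite expn_gt0 prime_gt0.
  (* i = 3 works since 5 + 3 <= 3 F_4. *)
  apply: (@lucas_gap 1 3); rewrite ?ltn_double //.
    by rewrite -[1]/(0.*2.+1) ltn_Sdouble.
  have p_gt1 := prime_gt1 p_pr.
  case: (ltngtP p 2) => [|p3|p2]; first by rewrite ltnNge p_gt1.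
    by move: p3 a0; clear; nia.
  have := gap2 p2; rewrite p2; case: (k) => // k' _; rewrite expnS.
  have : 0 < 2 ^ k' by rewrite expn_gt0.
  by move: (2 ^ k') => x; clear; lia.
pose p := pdiv D; have p_pr : prime p := pdiv_prime D_gt1.
have pD : p %| D := pdiv_dvd D.
have [pn pf] := Dp p p_pr pD.
(* D is a power of p dividing (F_n / F_(n/p))^2, and p^2 does not divide the quotient. *)
have Dp2 : D <= p ^ 2.
  have pnatD : p.-nat D.
    apply/pnatP => // q q_pr qD; apply/eqP.
    by case: (ltngtP q p) => // lt_pq; have [] : False by apply: (uniq_p _ _ _ _ _ _ lt_pq).
  have G0 : 0 < G p.
    by rewrite divn_gt0 ?fib_gt0 ?divr0 // leq_fib // leq_pmull // prime_gt0.
  rewrite -(part_pnat_id pnatD) p_part leq_pexp2l ?prime_gt0 //.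
  apply: leq_trans (dvdn_leq_log p _ (DG p p_pr pn)) _.
    by rewrite expn_gt0 G0.
  rewrite lognX -[2 in X in _ <= X]muln1 leq_pmul2l // leqNgt -pfactor_dvdn //.
  apply: fib_quotient_prime_sq => //; first exact: divr0.
  (* For p = 2, 6 divides n/2 and F_6 = 8. *)
  move=> p2; rewrite p2 in pD; have [[|k] // k1 ->] := D2 pD.
  rewrite p2 expnS -mulnA mulKn // expnS mulnAC.
  by apply: dvdn_trans (dvdn_fib (dvdn_mulr _ (dvdnn (2 * 3)))).
have [z pz En] := pfactor_coprime p_pr n0.
have : 0 < logn p n by rewrite logn_gt0 mem_primes p_pr n0 pn.
case El : (logn p n) => [//|k] _; rewrite El mulnC in En.
rewrite prime_coprime // in pz.
have z0 : 0 < z by case: z pz {En} => //; rewrite dvdn0.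
have := Dlow p k z p_pr pz En; apply/negP.
have a0 : 0 < p ^ k by rewrite expn_gt0 prime_gt0.
have a1 : 1 < (p ^ k).*2 by rewrite -[1]/(0.*2.+1) ltn_Sdouble.
apply: (@Cyclotomic_resultant_gap _ (p ^ 2)) => //; first by rewrite expn_gt0 prime_gt0.
rewrite [p ^ k.+1]expnS doubleMr.
have [p7 | p_lt7] := leqP 7 p.
  (* Here i = 2(p - 1), as j = 2 p^k >= 2 gives p j >= j + i. *)
  have p0 := prime_gt0 p_pr; apply: (@lucas_gap _ p.-1.*2) => //.
    by move: p0 a0; clear; nia.
  by rewrite -{1}(prednK p0); apply: fib_gt_sq; rewrite -ltnS prednK.
have : [|| p == 2, p == 3 | p == 5].
  by move: p_pr p_lt7; clearbody p; clear; case: p => [|[|[|[|[|[|[|p]]]]]]].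
case/or3P => /eqP p_eq.
- rewrite p_eq in pD El *; have [k' k1 En'] := D2 pD.
  move: El; rewrite En' lognM ?expn_gt0 // pfactorK // addn0 => -[<-].
  (* 5 * 4 + 3 <= 3 F_6, and k >= 2 gives j >= 8. *)
  apply: (@lucas_gap _ 5) => //.
    by rewrite -[1]/(0.*2.+1) ltn_Sdouble expn_gt0.
  case: k' k1 {En'} => [|[|l]] // _; rewrite !expnS.
  have : 0 < 2 ^ l by rewrite expn_gt0.
  by move: (2 ^ l) => x; clear; lia.
- rewrite p_eq in pD El *; have [k' k1 En'] := D3 pD.
  move: El; rewrite En' lognM ?expn_gt0 // pfactorK // addn0 => -[<-].
  (* 5 * 9 + 3 <= 3 F_8, and k >= 1 gives j >= 6. *)
  apply: (@lucas_gap _ 7) => //.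
    by rewrite -[1]/(0.*2.+1) ltn_Sdouble expn_gt0.
  case: k' k1 {En'} => [|l] // _; rewrite !expnS.
  have : 0 < 3 ^ l by rewrite expn_gt0.
  by move: (3 ^ l) => x; clear; lia.
- by rewrite p_eq (negPf D5) in pD.
Qed.

(** * Products of Fibonacci numbers *)

Lemma fib_cassini n : ((fib n.+1)%:Z ^+ 2
  = (fib n)%:Z * (fib n.+1)%:Z + (fib n)%:Z ^+ 2 + (-1) ^+ n)%R.
Proof. by have [_ _ <-] := lucas_double n; ring. Qed.

(** With x = F_n and y = F_(n+1), L_(n+1) = 2x + y, and Cassini turns y^2 into xy + x^2 + 1. *)
Lemma lucas_sq_odd n : ~~ odd n -> lucas n.+1 ^ 2 = 5 * fib n * fib n.+2 + 1.
Proof.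
move=> n_even; have := fib_cassini n.
rewrite -signr_odd (negPf n_even) expr0 lucasS fibSS.
by move: (fib n) (fib n.+1) => x y; rewrite !expnS expn0; nia.
Qed.

(** The form of F_(3m) / F_m = L_m^2 - 1 free of subtraction and division, again by Cassini. *)
Lemma fib_triple m : ~~ odd m -> fib (3 * m) + fib m = fib m * lucas m ^ 2.
Proof.
case: m => // n; rewrite oddS negbK => n_odd; have := fib_cassini n.
rewrite -signr_odd n_odd expr1.
have -> : 3 * n.+1 = n.+1 + (n.+1 + n.+1) by lia.
rewrite fibDS -addnS !fibDS lucasS !fibSS.
by move: (fib n) (fib n.+1) => x y; rewrite !expnS expn0; nia.
Qed.

Lemma prime_dvd_prod_fib p (s : seq nat) : prime p ->
  p %| \prod_(n <- s) fib n -> exists2 n, n \in s & p %| fib n.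
Proof.
move=> p_pr; elim: s => [|n s IH].
  by rewrite big_nil dvdn1 => /eqP p1; rewrite p1 in p_pr.
rewrite big_cons Euclid_dvdM // => /orP[pn | /IH[k ks pk]].
  by exists n; rewrite // mem_head.
by exists k; rewrite // inE ks orbT.
Qed.

Lemma fib_dvd_prod (s : seq nat) n : n \in s -> fib n %| \prod_(k <- s) fib k.
Proof. by move=> ns; rewrite (big_rem n) //= dvdn_mulr. Qed.

(** The multiple is the index of a factor divisible by a primitive prime of F_n. The hypothesis
    covers only primitive primes because for n = 3m others may be cancelled by F_m. *)
Lemma fib_prod_multiple n (s : seq nat) : 12 < n -> ~~ odd n ->
    (forall p, prime p -> p %| fib n -> (forall j, 0 < j < n -> ~~ (p %| fib j)) ->
      p %| \prod_(k <- s) fib k) ->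
  exists2 k, k \in s & n %| k.
Proof.
move=> n12 n_even dvd_prod.
have [p p_pr [pn np]] := fib_primitive_divisor n12 n_even.
have [k ks pk] := prime_dvd_prod_fib p_pr (dvd_prod p p_pr pn np).
exists k => //; rewrite -(@dvdn_fib_rank p) //; first exact: ltn_trans n12.
by apply/allP => j; rewrite mem_iota => jn; apply: np; lia.
Qed.

(** The product is F_(3m) / F_m, yet some index is a multiple of 3m, so it is at least F_(3m). *)
Lemma even_no_solution m s : ~~ odd m -> 6 <= m -> ~ is_solution m s.
Proof.
move=> m_even m6 [_ _ Es]; set P := \prod_(n <- s) fib n in Es.
have m0 : 0 < m by lia.
have E3 : fib (3 * m) = fib m * P.
  by have := fib_triple m_even; rewrite -Es; lia.
have f3 : 0 < fib (3 * m) by apply: fib_gt0; lia.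
have P0 : 0 < P by move: f3; rewrite E3 muln_gt0 => /andP[].
have [|||n ns mn] := @fib_prod_multiple (3 * m) s; first by lia.
- by rewrite oddM negb_and m_even orbT.
- move=> p p_pr; rewrite E3 Euclid_dvdM // => /orP[pm np | //].
  by case/negP: (np m (ltac:(lia))).
have : fib (3 * m) <= P.
  apply: dvdn_leq => //; apply: dvdn_trans (fib_dvd_prod ns).
  exact: dvdn_fib.
by rewrite E3 leqNgt ltn_Pmull // fib_gt1 // (leq_trans _ m6).
Qed.

(** Some index is a positive multiple of n, and 2n or more is too large: F_(2n) = F_n L_n > c
    F_n. *)
Lemma fib_factor_extract n c s : 12 < n -> ~~ odd n -> 0 < c < lucas n ->
    \prod_(k <- s) fib k = c * fib n ->
  n \in s /\ \prod_(k <- rem n s) fib k = c.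
Proof.
move=> n12 n_even /andP[c0 cL] Es; have n0 : 0 < n := ltn_trans (isT : 0 < 12) n12.
have fn0 := fib_gt0 n0.
have [|k ks /dvdnP[q Ek]] := @fib_prod_multiple n s n12 n_even.
  by move=> p p_pr pn _; rewrite Es dvdn_mull.
suff q1 : q = 1.
  rewrite Ek q1 mul1n in ks; split=> //; apply/eqP.
  by rewrite -(@eqn_pmul2r (fib n)) // -Es [X in _ == X](big_rem n) //= mulnC.
have := fib_dvd_prod ks; rewrite Es => kd.
case: q Ek => [|[|q]] // Ek.
  by move: kd; rewrite Ek dvd0n muln_eq0 !gtn_eqF.
have := dvdn_leq _ kd; rewrite muln_gt0 c0 fn0 => /(_ isT).
have : fib (n + n) <= fib k by apply: leq_fib; rewrite Ek; lia.
have -> : fib (n + n) = fib n * lucas n.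
  by case: (n) n0 => // n' _; rewrite fibDS lucasS; lia.
by move: cL fn0; clear; nia.
Qed.

(** * The finite search for factorizations into Fibonacci numbers *)

(* Binary counterparts, on which the finite search can be run by vm_compute. *)
Definition fibN n : N := (iter n (fun p => (p.2, N.add p.1 p.2)) (0%num, 1%num)).1.

Definition lucasN n : N := (iter n (fun p => (p.2, N.add p.1 p.2)) (2%num, 1%num)).1.

Lemma fibN_of_nat n : fibN n = N.of_nat (fib n).
Proof.
rewrite /fibN; suff -> : iter n (fun p => (p.2, N.add p.1 p.2)) (0%num, 1%num)
  = (N.of_nat (fib n), N.of_nat (fib n.+1)) by [].
by elim: n => //= n ->; rewrite addnC Nat2N.inj_add.
Qed.

Lemma lucasN_of_nat n : lucasN n = N.of_nat (lucas n).
Proof.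
rewrite /lucasN; suff -> : iter n (fun p => (p.2, N.add p.1 p.2)) (2%num, 1%num)
  = (N.of_nat (lucas n), N.of_nat (lucas n.+1)) by [].
by elim: n => //= n ->; rewrite addnC Nat2N.inj_add.
Qed.

Definition prod_fibN (s : seq nat) : N := foldr (fun n => N.mul (fibN n)) 1%num s.

Lemma prod_fibN_of_nat s : prod_fibN s = N.of_nat (\prod_(n <- s) fib n).
Proof.
elim: s => [|n s IH] /=; first by rewrite big_nil.
by rewrite IH fibN_of_nat big_cons Nat2N.inj_mul.
Qed.

(** Trial division with nondecreasing indices lo <= n < bound; [fuel] limits the number of
    factors. *)
Fixpoint fib_factorizations (bound fuel lo : nat) (c : N) : seq (seq nat) :=
  if N.eqb c 1 then [:: [::]] else
  if fuel is fuel'.+1 then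
    flatten [seq [seq n :: t | t <- fib_factorizations bound fuel' n (N.div c (fibN n))]
            | n <- iota lo (bound - lo) & N.eqb (N.modulo c (fibN n)) 0]
  else [::].

Lemma prod_fib_ge s : all (leq 3) s -> 2 ^ size s <= \prod_(k <- s) fib k.
Proof.
elim: s => [|n s IH] /=; first by rewrite big_nil.
by case/andP=> n3 s3; rewrite big_cons expnS leq_mul ?fib_gt1 ?IH.
Qed.

Lemma fib_factorizationsP bound fuel lo s : 2 < lo -> path leq lo s -> size s <= fuel ->
    \prod_(k <- s) fib k < fib bound ->
  s \in fib_factorizations bound fuel lo (prod_fibN s).
Proof.
elim: fuel lo s => [|fuel IH] lo [|n s] lo2 //.
move=> /andP[lo_n ns] size_s.
have n3 : 2 < n := leq_trans lo2 lo_n.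
have fn : 1 < fib n := fib_gt1 n3.
have P0 : 0 < \prod_(k <- s) fib k.
  apply: leq_trans (prod_fib_ge _); first by rewrite expn_gt0.
  by apply/allP => k /(allP (order_path_min leq_trans ns)); apply: leq_trans.
rewrite big_cons => lt_bound.
have n_bound : n < bound.
  rewrite ltnNge; apply/negP => /leq_fib; move: lt_bound fn P0.
  by move: (\prod_(k <- s) _) (fib n) (fib _) => P F B; clear; nia.
have sP : s \in fib_factorizations bound fuel n (prod_fibN s).
  apply: IH => //; apply: leq_ltn_trans lt_bound.
  by rewrite leq_pmull // ltnW.
have F0 : fibN n <> 0%num by rewrite fibN_of_nat; lia.
rewrite /fib_factorizations -/fib_factorizations.
have -> : N.eqb (prod_fibN (n :: s)) 1 = false.
  apply/negP => /N.eqb_eq; rewrite prod_fibN_of_nat big_cons.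
  by move: fn P0; move: (\prod_(k <- s) _) (fib n) => P F; clear; nia.
apply/flattenP; exists [seq n :: t | t <- fib_factorizations bound fuel n (prod_fibN s)].
  apply/mapP; exists n; last first.
    by rewrite /= [N.mul _ _]N.mul_comm N.div_mul.
  rewrite mem_filter mem_iota /= [N.mul _ _]N.mul_comm N.Div0.mod_mul.
  by rewrite lo_n subnKC // (leq_trans lo_n) // ltnW.
exact: map_f.
Qed.

Lemma ltn_fib_exp2 n : fib n < 2 ^ n.
Proof.
suff /andP[] : (fib n < 2 ^ n) && (fib n.+1 < 2 ^ n.+1) by [].
elim: n => // n /andP[IH1 IH2]; rewrite IH2 fibSS !expnS.
by move: IH1 IH2; rewrite expnS; lia.
Qed.

(** Factors are at least 2 and F_bound < 2^bound, so there are fewer than [bound] of them and the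
    fuel suffices. *)
Lemma fib_factorizations_complete bound s : sorted leq s -> all (leq 3) s ->
    N.ltb (prod_fibN s) (fibN bound) ->
  s \in fib_factorizations bound bound 3 (prod_fibN s).
Proof.
move=> s_sorted s3 /N.ltb_lt; rewrite {1}prod_fibN_of_nat fibN_of_nat => lt_N.
have lt_nat : \prod_(k <- s) fib k < fib bound.
  by move: lt_N; move: (\prod_(k <- s) _) (fib _) => P B; clear; lia.
apply: fib_factorizationsP => //.
  by rewrite path_min_sorted.
rewrite -(@leq_exp2l 2) //; apply: leq_trans (prod_fib_ge s3) _.
by apply: ltnW; apply: ltn_trans lt_nat _; apply: ltn_fib_exp2.
Qed.

Definition solutionN m s : bool :=
  N.eqb (N.add (prod_fibN s) 1) (N.mul (lucasN m) (lucasN m)).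

Lemma solutionNP m s :
  reflect (\prod_(n <- s) fib n + 1 = lucas m ^ 2) (solutionN m s).
Proof.
rewrite /solutionN prod_fibN_of_nat lucasN_of_nat expnS expn1.
by apply: (iffP idP) => [/N.eqb_eq | E]; [lia | apply/N.eqb_eq; lia].
Qed.

Definition listed m s : bool :=
  ((m, s) \in sporadic_solutions) || [&& odd m, 7 <= m & s == [:: 5; m - 1; m + 1]].

Lemma listedP m s :
  reflect (((m, s) \in sporadic_solutions) \/
           [/\ odd m, 7 <= m & s = [:: 5; m - 1; m + 1]]) (listed m s).
Proof.
apply: (iffP orP) => -[ms | H]; [by left | right | by left | right].
  by case/and3P: H => ? ? /eqP.
by case: H => -> -> ->; rewrite eqxx.
Qed.

(** m = 1 is absent because L_1^2 - 1 = 0 is not a product of positive factors; odd m from 15 on are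
    left to the primitive divisor argument. *)
Lemma small_solutions m s : m \in [:: 0; 2; 3; 4; 5; 7; 9; 11; 13] ->
  is_solution m s -> all (leq 3) s -> listed m s.
Proof.
pose prodN m := N.pred (N.mul (lucasN m) (lucasN m)).
(* F_30 exceeds L_13^2, so no index is at least 30. *)
have ok : all (fun m => N.ltb (prodN m) (fibN 30) &&
    all (listed m) (fib_factorizations 30 30 3 (prodN m)))
    [:: 0; 2; 3; 4; 5; 7; 9; 11; 13] by vm_compute.
move=> /(allP ok) {ok} /andP[lt30 /allP list_m] [_ s_sorted /solutionNP /N.eqb_eq E] s3.
have Es : prodN m = prod_fibN s by rewrite /prodN -E N.add_1_r N.pred_succ.
rewrite Es in lt30 list_m.
by apply: list_m; apply: fib_factorizations_complete.
Qed.

Lemma five_factorization s : all (leq 3) s -> sorted leq s ->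
  \prod_(k <- s) fib k = 5 -> s = [:: 5].
Proof.
move=> s3 s_sorted Es; have EN : prod_fibN s = 5%num by rewrite prod_fibN_of_nat Es.
have := @fib_factorizations_complete 30 s s_sorted s3; rewrite EN.
have -> : N.ltb 5 (fibN 30) by vm_compute.
have -> : fib_factorizations 30 30 3 5 = [:: [:: 5]] by vm_compute.
by move=> /(_ isT); rewrite inE => /eqP.
Qed.

(** With n = m - 1 the product is 5 F_n F_(n+2). The index n + 2 splits off since 5 F_n < L_(n+2),
    then n since 5 < L_n, and the remaining product 5 allows only [[:: 5]]. *)
Lemma large_odd_solution m s : odd m -> 15 <= m -> is_solution m s ->
  all (leq 3) s -> s = [:: 5; m - 1; m + 1].
Proof.
case: m => // n; rewrite oddS ltnS => n_even n14 [_ s_sorted].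
rewrite lucas_sq_odd // => /addIn Es s3.
have [||||n2s Es'] := @fib_factor_extract n.+2 (5 * fib n) s.
- by lia.
- by rewrite !oddS negbK.
- rewrite muln_gt0 /= fib_gt0 ?(leq_trans _ n14) //.
  case: (n) n14 => [|[|[|k]]] // _; rewrite !lucasS !fibSS.
  have : 0 < fib k.+1 := fib_gt0 (ltn0Sn k); lia.
- by [].
have [||||ns Es''] := @fib_factor_extract n 5 (rem n.+2 s).
- by lia.
- by [].
- by rewrite (leq_trans _ (leq_lucas (m := 4) _ _)) //; lia.
- by [].
have sub_s : subseq (rem n (rem n.+2 s)) s.
  by apply: subseq_trans (rem_subseq _ _) (rem_subseq _ _).
have E5 : rem n (rem n.+2 s) = [:: 5].
  apply: five_factorization => //.
    by apply/allP => k /(mem_subseq sub_s) /(allP s3).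
  by apply: subseq_sorted sub_s s_sorted; apply: leq_trans.
rewrite subn1 addn1; apply: (sorted_eq leq_trans anti_leq) => //=.
  by rewrite (leq_trans _ n14) //= leqW.
apply: perm_trans (perm_to_rem n2s) _.
have := perm_to_rem ns; rewrite E5 => p.
apply: (@perm_trans _ [:: n.+2, n & [:: 5]]); first by rewrite perm_cons.
by rewrite -[[:: 5; n; n.+2]]/(rev [:: n.+2; n; 5]) perm_sym perm_rev.
Qed.

(** * The admissible m and the nontrivial solutions *)

Lemma solution_index m s : is_solution m s -> (m \in [:: 0; 2; 4]) \/ odd m.
Proof.
move=> sol; have [m_odd | m_even] := boolP (odd m); [by right | left].
have [m6 | m_lt6] := leqP 6 m; first by case: (even_no_solution m_even m6 sol).
by case: m m_even m_lt6 {sol} => [|[|[|[|[|[|m]]]]]].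
Qed.

Lemma lucas_eq1 m : lucas m = 1 -> m = 1.
Proof. by move=> E; apply/eqP; apply: contraTT isT => /lucas_gt1; rewrite E. Qed.

Theorem theorem4 :
  (forall m : nat,
     (exists s : seq nat, is_solution m s) <->
     (m \in [:: 0; 2; 4]) \/ odd m) /\
  (forall (m : nat) (s : seq nat),
     is_solution m s /\ nontrivial s <->
     ((m, s) \in sporadic_solutions) \/
     [/\ odd m, 7 <= m & s = [:: 5; m - 1; m + 1]]).
Proof.
have listed_sol m s : listed m s -> is_solution m s /\ nontrivial s.
  have ok : all (fun x => [&& 1 <= size x.2, sorted leq x.2, solutionN x.1 x.2 &
      (size x.2 == 1) || (2 <= size x.2) && (3 <= head 0 x.2)])
      sporadic_solutions by vm_compute.
  case/orP => [/(allP ok) /and4P[/= s1 s2 /solutionNP s3 s4] | ].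
    by split; [split | case/orP: s4 => [/eqP | /andP]; [left | right]].
  case/and3P=> m_odd m7 /eqP ->; split; last by right.
  (* m >= 7 gives 5 <= m - 1, so the tuple is sorted. *)
  split=> //=; first by lia.
  case: m m_odd m7 => // n; rewrite oddS subn1 addn1 => n_even _.
  by rewrite lucas_sq_odd // !big_cons big_nil muln1 mulnA !addn1.
split=> [m|m s].
  split=> [[s /solution_index] // | Hm].
  (* Witnesses for the admissible m < 7; the infinite family serves the rest. *)
  have small : all (fun x => listed x.1 x.2) [:: (0, [:: 4]); (1, [:: 0]);
      (2, [:: 6]); (3, [:: 4; 5]); (4, [:: 3; 4; 6]); (5, [:: 4; 5; 6])].
    by vm_compute.
  have [m7 | ] := leqP 7 m.
    exists [:: 5; m - 1; m + 1]; apply: (listed_sol m _ _).1.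
    apply/listedP; right; split=> //; case: Hm => //.
    by rewrite !inE => /or3P[] /eqP Em; rewrite Em in m7.
  case: m Hm => [|[|[|[|[|[|[|m]]]]]]] // Hm _.
  - by exists [:: 4]; apply: (listed_sol _ _ _).1.
  - by exists [:: 0]; apply: (listed_sol _ _ _).1.
  - by exists [:: 6]; apply: (listed_sol _ _ _).1.
  - by exists [:: 4; 5]; apply: (listed_sol _ _ _).1.
  - by exists [:: 3; 4; 6]; apply: (listed_sol _ _ _).1.
  - by exists [:: 4; 5; 6]; apply: (listed_sol _ _ _).1.
  - by case: Hm.
split=> [[sol nontriv] | /listedP /listed_sol //]; apply/listedP.
have [_ s_sorted Es] := sol.
have [s3 | s_small] := boolP (all (leq 3) s).
  have P0 : 0 < \prod_(k <- s) fib k.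
    by apply: leq_trans (prod_fib_ge s3); rewrite expn_gt0.
  have [m_large | m_small] := leqP 15 m.
    have m_odd : odd m.
      case: (solution_index sol) => //; rewrite !inE.
      by case/or3P=> /eqP Em; rewrite Em in m_large.
    rewrite /listed m_odd (leq_trans _ m_large) //=.
    by rewrite [X in X == _](large_odd_solution m_odd m_large sol s3) eqxx orbT.
  apply: small_solutions => //.
  case: (solution_index sol) => [|m_odd]; first by rewrite !inE => /or3P[] /eqP ->.
  (* Positivity of the product rules out m = 1. *)
  case: m m_odd m_small {sol} Es => [|[|m]] // m_odd m_small Es.
    by move: P0; rewrite -(ltn_add2r 1) Es.
  by move: m_odd m_small {Es}; do 13! [case: m => [|m] //].
(* An index below 3 leaves k = 1: for k >= 2, sortedness and n_1 >= 3 would bound all indices from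
   below. *)
have [n Esn] : exists n, s = [:: n].
  case: nontriv => [|[s2 s3]]; first by case: (s) => [|n [|]] // _; exists n.
  case/negP: s_small; case: (s) s_sorted s3 => //= n t nt n3; rewrite n3 /=.
  by apply: sub_all (order_path_min leq_trans nt) => k; apply: leq_trans.
(* F_0 = 0 forces L_m = 1, while F_1 = F_2 = 1 would make 2 a square. *)
move: Es s_small; rewrite Esn big_seq1 /= andbT -ltnNge.
case: n {Esn} => [|[|[|n]]] //= E _.
- have /lucas_eq1 -> : lucas m = 1; last by [].
  by move: E; case: (lucas m) => [|[|l]] //; rewrite expnS expn1; lia.
- by move: E; case: (lucas m) => [|[|l]] //; rewrite expnS expn1; lia.
- by move: E; case: (lucas m) => [|[|l]] //; rewrite expnS expn1; lia.
Qed.
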